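(* Let $0<p<1$, $q=1-p$, let $\theta\in[0,2\pi)$ with $\theta\ne\frac{n\pi}{2}$ for $n=0,1,2,3$, and let $U\in O(2)$ be either $\begin{pmatrix}\cos\theta&-\sin\theta\\ \sin\theta&\cos\theta\end{pmatrix}$ or $\begin{pmatrix}\cos\theta&\sin\theta\\ \sin\theta&-\cos\theta\end{pmatrix}$. Then, for the decoherent quantum walk with coin operator $U$, for all $\nu\in[0,2\pi]$, $$\lim_{t\to\infty}\hat P\Big(\frac{\nu}{\sqrt t},t\Big)=\frac{1}{2\pi}\int_0^{2\pi}e^{-\frac12\,\frac{1+2q\cos(k)+q^2}{1-q^2}\cot^2(\theta)\,\nu^2}\,dk.$$
   Context: Decoherent quantum walk on the line: the state space is $H_p\otimes H_2$, where $H_p$ has basis $|x\rangle$, $x\in\mathbb{Z}$, and the coin space $H_2=\mathbb{C}^2$ has orthonormal basis $|R\rangle,|L\rangle$ (in this order for matrices). $P_R=|R\rangle\langle R|$, $P_L=|L\rangle\langle L|$, $S^{\pm}|x\rangle=|x\pm1\rangle$, and $E=(S^+\otimes P_R+S^-\otimes P_L)(I\otimes U)$. The measurement operators are $A_0=\sqrt{1-p}\,I$, $A_1=\sqrt p\,|R\rangle\langle R|$, $A_2=\sqrt p\,|L\rangle\langle L|$, and one step of the walk maps a density operator $\rho$ to $\sum_{n=0}^2E(I\otimes A_n)\rho(I\otimes A_n)^*E^*$. The walk starts at $|0\rangle\otimes|\Phi_0\rangle$ with $\Phi_0\in H_2$ an arbitrary unit vector; $\rho_t$ is the state after $t$ steps,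 $p(x,t)=\mathrm{Tr}\{(|x\rangle\langle x|\otimes I)\rho_t\}$, and $\hat P(\nu,t)=\sum_{x\in\mathbb{Z}}e^{i\nu x}p(x,t)$. *)

(* Defs.v *)
From mathcomp Require Import all_boot all_order all_algebra.
From mathcomp Require Import all_classical all_reals all_analysis.
From mathcomp Require Import complex.

Set Implicit Arguments.
Unset Strict Implicit.
Unset Printing Implicit Defensive.

Import Order.TTheory GRing.Theory Num.Theory.
Import numFieldNormedType.Exports.

Local Open Scope classical_set_scope.
Local Open Scope ring_scope.
Local Open Scope complex_scope.
Local Open Scope sesquilinear_scope.

Section Walk.
Variable R : realType.
Local Notation C := R[i].

(* The coin space has the ordered basis |R>, |L>, with indices 0, 1. *)
Definition ketR : 'cV[C]_2 := delta_mx 0 0.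
Definition ketL : 'cV[C]_2 := delta_mx 1 0.
Definition PR : 'M[C]_2 := ketR *m ketR ^t*.
Definition PL : 'M[C]_2 := ketL *m ketL ^t*.

(* An operator T on H_p is given by its entries T x y = <x|T|y>, and an operator
   M on H_p (x) H_2 by its 2 x 2 blocks M x y = (<x| (x) I) M (|y> (x) I). *)
Definition pos_op : Type := int -> int -> C.
Definition walk_op : Type := int -> int -> 'M[C]_2.

Definition id_pos : pos_op := fun x y => (x == y)%:R.
Definition shiftp : pos_op := fun x y => (x == y + 1)%:R.
Definition shiftm : pos_op := fun x y => (x == y - 1)%:R.
Definition proj_pos (z : int) : pos_op := fun x y => ((x == z) && (y == z))%:R.

Definition tensor (T : pos_op) (M : 'M[C]_2) : walk_op := fun x y => T x y *: M.

Definition op_add (M N : walk_op) : walk_op := fun x y => M x y + N x y.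

(* Sums over all of int are sums over the (finite) support of the summand. The
   support is finite in every use below: shifts, projections and the identity
   have finitely supported rows and columns, and the state after t steps has
   finitely many nonzero blocks. *)
Definition op_mul (M N : walk_op) : walk_op :=
  fun x y => \sum_(z \in [set: int]) M x z *m N z y.

Definition op_adj (M : walk_op) : walk_op := fun x y => (M y x) ^t*.

Definition op_tr (M : walk_op) : C := \sum_(x \in [set: int]) \tr (M x x).

Definition evol (U : 'M[C]_2) : walk_op :=
  op_mul (op_add (tensor shiftp PR) (tensor shiftm PL)) (tensor id_pos U).

Definition measA (p : R) (n : 'I_3) : 'M[C]_2 :=
  match val n with
  | 0%N => (Num.sqrt (1 - p))%:C%:M
  | 1%N => (Num.sqrt p)%:C *: PR
  | _ => (Num.sqrt p)%:C *: PL
  end.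

Definition step (U : 'M[C]_2) (p : R) (rho : walk_op) : walk_op :=
  fun x y => \sum_(n < 3)
    op_mul (op_mul (op_mul (op_mul (evol U) (tensor id_pos (measA p n))) rho)
                   (op_adj (tensor id_pos (measA p n))))
           (op_adj (evol U)) x y.

(* |0><0| (x) |Phi0><Phi0| *)
Definition rho0 (Phi0 : 'cV[C]_2) : walk_op :=
  tensor (proj_pos 0) (Phi0 *m Phi0 ^t*).

Definition rho (U : 'M[C]_2) (p : R) (Phi0 : 'cV[C]_2) (t : nat) : walk_op :=
  iter t (step U p) (rho0 Phi0).

Definition prob (U : 'M[C]_2) (p : R) (Phi0 : 'cV[C]_2) (x : int) (t : nat) : C :=
  op_tr (op_mul (tensor (proj_pos x) 1%:M) (rho U p Phi0 t)).

(* e^{i y} *)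
Definition cis (y : R) : C := cos y +i* sin y.

Definition Phat (U : 'M[C]_2) (p : R) (Phi0 : 'cV[C]_2) (nu : R) (t : nat) : C :=
  \sum_(x \in [set: int]) cis (nu * x%:~R) * prob U p Phi0 x t.

Definition mx2 (a b c d : R) : 'M[R]_2 :=
  \matrix_(i < 2, j < 2) (if i == 0 then if j == 0 then a else b
                          else if j == 0 then c else d).

Definition coin_rot (theta : R) : 'M[R]_2 :=
  mx2 (cos theta) (- sin theta) (sin theta) (cos theta).

Definition coin_refl (theta : R) : 'M[R]_2 :=
  mx2 (cos theta) (sin theta) (sin theta) (- cos theta).

Definition mxC m n (M : 'M[R]_(m, n)) : 'M[C]_(m, n) :=
  map_mx (fun x : R => x%:C) M.

Definition cot (x : R) : R := cos x / sin x.

End Walk.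

(* Main.v *)
Require Import Defs.
From mathcomp Require Import all_boot all_order all_algebra.
From mathcomp Require Import all_classical all_reals all_analysis.
From mathcomp Require Import complex ring lra zify.

Set Implicit Arguments.
Unset Strict Implicit.
Unset Printing Implicit Defensive.

Import Order.TTheory GRing.Theory Num.Theory.
Import numFieldNormedType.Exports.

Local Open Scope classical_set_scope.
Local Open Scope ring_scope.
Local Open Scope complex_scope.
Local Open Scope sesquilinear_scope.

(* Idea.  Grouping the blocks of the state by the relative position x - y = 2m
   and Fourier transforming in m turns one step into a linear map on 2 x 2
   matrices depending on a momentum k.  In Pauli coordinates, after dividing the
   three traceless coordinates by i, this map is a real contraction of R^4:
   a rotation by the coin, damping of the off-diagonal part by q, a rotation by k,
   and a rotation by e = nu / sqrt t mixing the trace with the z-coordinate.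

   For fixed k no spectral theory is needed: the linear form
   (a, z, x, y) |-> a + e (b . (z, x, y)), where b solves a 3 x 3 linear system, is
   an eigenform for exp(- v e^2 / 2) up to O(e^3), because the even and odd
   orders in e act on different coordinates.  Summing t such errors of size
   t^(-3/2) gives the Gaussian limit with variance v = v(k), and
   dominated convergence over k concludes. *)

(** * Asymptotics of the Bloch dynamics at fixed momentum *)

(** This bootstraps the Taylor bounds below: the derivative of each remainder is an earlier
    remainder, up to sign, so the bounds follow by raising the order one at a time. *)
Lemma derive_ge0_ge0 (R : realType) (f f' : R -> R) :
  (forall x : R, is_derive x (1 : R) f (f' x)) -> f 0 = 0 ->
  (forall x, 0 <= x -> 0 <= f' x) -> forall x, 0 <= x -> 0 <= f x.
Proof.
move=> df f0 f'0 x x0; rewrite -f0.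
apply: (ger0_derive1_ndecry (a := 0)) => //.
- move=> y; rewrite in_itv /= andbT derive1E (@derive_val _ _ _ _ _ _ _ (df y)).
  by move=> /ltW; exact: f'0.
- apply: continuous_subspaceT => y.
  by apply/differentiable_continuous/derivable1_diffP; exact: (@ex_derive _ _ _ _ _ _ _ (df y)).
Qed.

Lemma sin_le_id (R : realType) (x : R) : 0 <= x -> sin x <= x.
Proof.
move=> x0; rewrite -subr_ge0; move: x x0.
apply: (@derive_ge0_ge0 _ _ (fun x => 1 - cos x)); last 2 first.
- by rewrite sin0 subrr.
- by move=> x _; rewrite subr_ge0 cos_le1.
Qed.

Lemma cos_ge_taylor2 (R : realType) (x : R) : 0 <= x -> 1 - x ^+ 2 / 2 <= cos x.
Proof.
move=> x0; rewrite -subr_ge0; move: x x0.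
apply: (@derive_ge0_ge0 _ _ (fun x => x - sin x)); last 2 first.
- by rewrite cos0 expr0n /= mul0r subr0 subrr.
- by move=> x x0; rewrite subr_ge0 sin_le_id.
move=> x; apply: is_derive_eq.
by rewrite /GRing.scale /=; field.
Qed.

Lemma sin_ge_taylor3 (R : realType) (x : R) : 0 <= x -> x - x ^+ 3 / 6 <= sin x.
Proof.
move=> x0; rewrite -subr_ge0; move: x x0.
apply: (@derive_ge0_ge0 _ _ (fun x => cos x - (1 - x ^+ 2 / 2))); last 2 first.
- by rewrite sin0 expr0n /= mul0r subr0 subrr.
- by move=> x x0; rewrite subr_ge0 cos_ge_taylor2.
move=> x; apply: is_derive_eq.
by rewrite /GRing.scale /=; field.
Qed.

Lemma cos_le_taylor4 (R : realType) (x : R) :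
  0 <= x -> cos x <= 1 - x ^+ 2 / 2 + x ^+ 4 / 24.
Proof.
move=> x0; rewrite -subr_ge0; move: x x0.
apply: (@derive_ge0_ge0 _ _ (fun x => sin x - (x - x ^+ 3 / 6))); last 2 first.
- by rewrite cos0 !expr0n /= !mul0r subr0 addr0 subrr.
- by move=> x x0; rewrite subr_ge0 sin_ge_taylor3.
move=> x; apply: is_derive_eq.
by rewrite /GRing.scale /=; field.
Qed.

Lemma expRN_le_taylor2 (R : realType) (x : R) :
  0 <= x -> expR (- x) <= 1 - x + x ^+ 2 / 2.
Proof.
move=> x0; rewrite -subr_ge0; move: x x0.
apply: (@derive_ge0_ge0 _ _ (fun x => expR (- x) - (1 - x))); last 2 first.
- by rewrite oppr0 expR0 !expr0n /= mul0r !addr0 subrr.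
- by move=> x x0; rewrite subr_ge0 expR_ge1Dx.
move=> x; apply: is_derive_eq.
by rewrite /GRing.scale /=; field.
Qed.

(* Coordinates (a, z, x, y): a is the trace, and z, x, y are the Pauli coordinates
   divided by i, which makes the dynamics real.  (c, s) are the cosine and sine
   of the coin angle, f is the momentum, and q < 0 encodes a reflection coin. *)
Definition bloch_step (R : realType) (q c s f e : R) (u : R * R * R * R) :=
  let: (a, z, x, y) := u in
  let z1 := (c ^+ 2 - s ^+ 2) * z - 2 * c * s * q * x in
  let x1 := 2 * c * s * z + (c ^+ 2 - s ^+ 2) * q * x in
  let y1 := q * y in
  (cos e * a - sin e * z1, sin e * a + cos e * z1,
   cos f * x1 + sin f * y1, cos f * y1 - sin f * x1).

Definition bloch_norm2 (R : realType) (u : R * R * R * R) :=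
  let: (a, z, x, y) := u in a ^+ 2 + z ^+ 2 + x ^+ 2 + y ^+ 2.

(** Of the factors of a step, the rotations of the planes (z, x), (a, z) and (x, y) are isometries.
    Only the multiplication of x and y by [q] changes the norm. *)
Lemma bloch_step_contract (R : realType) (q c s f e : R) u :
  c ^+ 2 + s ^+ 2 = 1 -> q ^+ 2 <= 1 ->
  bloch_norm2 (bloch_step q c s f e u) <= bloch_norm2 u.
Proof.
move=> cs1 q1; case: u => [[[a z] x] y] /=.
have C1 : (c ^+ 2 - s ^+ 2) ^+ 2 + (2 * c * s) ^+ 2 = 1.
  by rewrite (_ : _ + _ = (c ^+ 2 + s ^+ 2) ^+ 2); [rewrite cs1 expr1n|ring].
set C := c ^+ 2 - s ^+ 2 in C1 *; set S := 2 * c * s in C1 *.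
have e1 := cos2Dsin2 e; have f1 := cos2Dsin2 f.
rewrite [leLHS](_ : _ =
  (cos e ^+ 2 + sin e ^+ 2) * (a ^+ 2 + (C * z - S * q * x) ^+ 2) +
  (cos f ^+ 2 + sin f ^+ 2) * ((S * z + C * q * x) ^+ 2 + (q * y) ^+ 2));
  last by ring.
rewrite e1 f1 !mul1r [leLHS](_ : _ =
  a ^+ 2 + (C ^+ 2 + S ^+ 2) * z ^+ 2 + (C ^+ 2 + S ^+ 2) * q ^+ 2 * x ^+ 2
    + q ^+ 2 * y ^+ 2); last by ring.
rewrite C1 !mul1r !lerD// ?ler_piMl// ?sqr_ge0//.
Qed.

(* The solution b of (b - e_z) T = b, where T is the (z, x, y) block of bloch_step
   at e = 0; this cancels the first order in e. *)
Definition corr_scale (R : realType) (q c s : R) : R := - q * (c / s) / (1 - q ^+ 2).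

Definition corrector (R : realType) (q c s f : R) : R * R * R :=
  let K := corr_scale q c s in
  (1 + c / s * (K * (q - cos f)) - (2 * s ^+ 2)^-1,
   - (1 - q * cos f) * K, - (q * sin f * K)).

Definition dot3 (R : realType) (b : R * R * R) (u : R * R * R * R) : R :=
  let: (bz, bx, b_y) := b in let: (a, z, x, y) := u in bz * z + bx * x + b_y * y.

(** The limiting variance at momentum [f]. The minus sign becomes the plus sign of the theorem by
    taking [f] = k + pi for a rotation coin, and by the negative [q] for a reflection coin. *)
Definition walk_var (R : realType) (q c s f : R) : R :=
  (1 - 2 * q * cos f + q ^+ 2) / (1 - q ^+ 2) * (c / s) ^+ 2.

(** With b_z the first entry of the corrector, the coefficient of a after one step is cos e + e b_z
    sin e = 1 - (1 - 2 b_z) e^2 / 2 + O(e^4). The left side is therefore the variance read off at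
    second order. *)
Lemma walk_var_corrector (R : realType) (q c s f : R) :
  c ^+ 2 + s ^+ 2 = 1 -> s != 0 -> q ^+ 2 < 1 ->
  1 - 2 * (corrector q c s f).1.1 = walk_var q c s f.
Proof.
move=> cs1 s0 q1 /=; rewrite /walk_var /corr_scale.
have q0 : 1 - q ^+ 2 != 0 by rewrite subr_eq0 eq_sym lt_eqF.
have -> : (2 * s ^+ 2)^-1 = 2^-1 + (c / s) ^+ 2 / 2.
  have -> : (2 * s ^+ 2)^-1 = (c ^+ 2 + s ^+ 2) * (2 * s ^+ 2)^-1.
    by rewrite cs1 mul1r.
  by field.
by field; rewrite s0 q0.
Qed.

(** The numerator is the squared modulus of q - e^{if}. *)
Lemma walk_var_ge0 (R : realType) (q c s f : R) :
  q ^+ 2 < 1 -> 0 <= walk_var q c s f.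
Proof.
move=> q1; rewrite /walk_var mulr_ge0 ?sqr_ge0// divr_ge0//; last first.
  by rewrite subr_ge0 ltW.
have f1 := cos2Dsin2 f.
rewrite [leRHS](_ : _ = (q - cos f) ^+ 2 + sin f ^+ 2).
  by rewrite addr_ge0 ?sqr_ge0.
by lra.
Qed.

Lemma corrector_eq (R : realType) (q c s f : R) (z x y : R) :
  c ^+ 2 + s ^+ 2 = 1 -> s != 0 -> q ^+ 2 < 1 ->
  let z1 := (c ^+ 2 - s ^+ 2) * z - 2 * c * s * q * x in
  let x1 := 2 * c * s * z + (c ^+ 2 - s ^+ 2) * q * x in
  let y1 := q * y in
  dot3 (corrector q c s f)
    (0, z1, cos f * x1 + sin f * y1, cos f * y1 - sin f * x1) - z1 =
  dot3 (corrector q c s f) (0, z, x, y).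
Proof.
move=> cs1 s0 q1; rewrite /dot3 /corrector.
set K := corr_scale q c s; set bz := (1 + _ - _).
set bx := - (1 - _) * _; set b_y := - (_ * _ * K).
have q0 : 1 - q ^+ 2 != 0 by rewrite subr_eq0 eq_sym lt_eqF.
(* [HA] is the coefficient of x1 once the rotation by [f] is moved onto b. [Hz], [Hx] and [Hy] then
   compare the coefficients of z, x and y on the two sides. *)
have HA : bx * cos f - b_y * sin f = K * (q - cos f).
  rewrite /bx /b_y [RHS](_ : _ =
    K * (q * (cos f ^+ 2 + sin f ^+ 2) - cos f)); first by ring.
  by rewrite cos2Dsin2 mulr1.
have hC : c ^+ 2 - s ^+ 2 = 1 - 2 * s ^+ 2 by lra.
have hbz : bz - 1 = c / s * (K * (q - cos f)) - (2 * s ^+ 2)^-1.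
  by rewrite /bz; ring.
have Hz : (bz - 1) * (1 - 2 * s ^+ 2) + K * (q - cos f) * (2 * c * s) = bz.
  rewrite -[RHS](subrK 1) hbz.
  by field.
have Hx : q * (- (2 * c * s) * (bz - 1) + (1 - 2 * s ^+ 2) * (K * (q - cos f))) = bx.
  rewrite hbz.
  rewrite [X in q * X](_ : _ = c / s - K * (q - cos f) * (2 * (c ^+ 2 + s ^+ 2) - 1)).
    rewrite cs1 /bx /K /corr_scale; field; by rewrite s0 q0.
  by field.
have Hy : q * (bx * sin f + b_y * cos f) = b_y by rewrite /bx /b_y; ring.
rewrite /= hC -[in RHS]Hz -[in RHS]Hx -[in RHS]Hy -HA; ring.
Qed.

Definition ell (R : realType) (e : R) (b : R * R * R) (u : R * R * R * R) : R :=
  u.1.1.1 + e * dot3 b u.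

Lemma bloch_coord_le (R : realType) (u : R * R * R * R) (N : R) :
  0 <= N -> bloch_norm2 u <= N ^+ 2 ->
  [/\ `|u.1.1.1| <= N, `|u.1.1.2| <= N, `|u.1.2| <= N & `|u.2| <= N].
Proof.
case: u => [[[a z] x] y] /= N0 uN.
have key (w : R) : w ^+ 2 <= N ^+ 2 -> `|w| <= N.
  by move=> wN; rewrite -(ler_pXn2r (n := 2))// ?nnegrE// -normrX ger0_norm// sqr_ge0.
have [? ? ? ?] := And4 (sqr_ge0 a) (sqr_ge0 z) (sqr_ge0 x) (sqr_ge0 y).
by split; apply: key; lra.
Qed.

Lemma normrM_le (R : realType) (x y X Y : R) :
  `|x| <= X -> `|y| <= Y -> `|x * y| <= X * Y.
Proof. by move=> xX yY; rewrite normrM ler_pM. Qed.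

Lemma normrD_le (R : realType) (x y X Y : R) :
  `|x| <= X -> `|y| <= Y -> `|x + y| <= X + Y.
Proof. by move=> xX yY; rewrite (le_trans (ler_normD _ _))// lerD. Qed.

(** The constant is uniform in [e] and in the ball of radius [N]. This lets the error be summed
    along an orbit that stays in the ball, with [e] depending on the number of steps. *)
Lemma ell_step_error (R : realType) (q c s f B N : R) :
  c ^+ 2 + s ^+ 2 = 1 -> s != 0 -> q ^+ 2 < 1 -> 0 <= N ->
  let b := corrector q c s f in let v := walk_var q c s f in
  `|b.1.1| <= B -> `|b.1.2| <= B -> `|b.2| <= B ->
  exists2 K : R, 0 <= K & forall (e : R) (u : R * R * R * R),
    0 <= e <= 1 -> bloch_norm2 u <= N ^+ 2 ->
    `|ell e b (bloch_step q c s f e u) - expR (- (v * e ^+ 2 / 2)) * ell e b u|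
      <= K * e ^+ 3.
Proof.
move=> cs1 s0 q1 N0 b v bz bx b_y.
have B0 : 0 <= B by rewrite (le_trans _ bz).
have v0 : 0 <= v by exact: walk_var_ge0.
have nv : `|v| <= v by rewrite ger0_norm.
(* The six summands are the bounds [n1] to [n6] of the six error terms found below, in that
   order. *)
pose K := N + B * N + 2 * N + 2 * B * N + v * (3 * (B * N)) + v ^+ 2 * (N + 3 * (B * N)).
have BN0 : 0 <= B * N by rewrite mulr_ge0.
have vBN0 : 0 <= v * (B * N) by rewrite mulr_ge0.
exists K.
  rewrite /K; have := sqr_ge0 v.
  have : 0 <= v ^+ 2 * (N + 3 * (B * N)).
    by rewrite mulr_ge0 ?sqr_ge0 ?addr_ge0 ?mulr_ge0.
  by lra.
move=> e u /andP[e0 e1] uN.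
have e2 : 0 <= e ^+ 2 <= e by rewrite sqr_ge0/= expr2 ler_piMl.
have e3 : 0 <= e ^+ 3 <= e ^+ 2 by rewrite exprn_ge0//= exprS ler_piMl// sqr_ge0.
have e4 : 0 <= e ^+ 4 <= e ^+ 3 by rewrite exprn_ge0//= exprS ler_piMl// exprn_ge0.
have h1 : `|cos e - 1 + e ^+ 2 / 2| <= e ^+ 3.
  by have := cos_ge_taylor2 e0; have := cos_le_taylor4 e0; rewrite ler_norml; lra.
have h2 : `|e - sin e| <= e ^+ 3.
  by have := sin_le_id e0; have := sin_ge_taylor3 e0; rewrite ler_norml; lra.
have h3 : `|cos e - 1| <= e ^+ 2.
  by have := cos_le1 e; have := cos_ge_taylor2 e0; rewrite ler_norml; lra.
have h4 : `|1 - v * e ^+ 2 / 2 - expR (- (v * e ^+ 2 / 2))| <= v ^+ 2 * e ^+ 3.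
  have w0 : 0 <= v * e ^+ 2 / 2 by rewrite divr_ge0// mulr_ge0// sqr_ge0.
  have := expR_ge1Dx (- (v * e ^+ 2 / 2)); have := expRN_le_taylor2 w0.
  rewrite (_ : (v * e ^+ 2 / 2) ^+ 2 = v ^+ 2 * e ^+ 4 / 4); last by field.
  have : v ^+ 2 * e ^+ 4 <= v ^+ 2 * e ^+ 3.
    by rewrite ler_wpM2l ?sqr_ge0//; case/andP: e4.
  have : 0 <= v ^+ 2 * e ^+ 4 by rewrite mulr_ge0 ?sqr_ge0//; case/andP: e4.
  by rewrite ler_norml; lra.
have [na nz nx ny] := bloch_coord_le N0 uN.
have ne : `|e| <= 1 by rewrite ger0_norm.
have ne' : `|e| <= e by rewrite ger0_norm.
have hq : `|q| <= 1.
  by rewrite -(ler_pXn2r (n := 2))// ?nnegrE// -normrX ger0_norm ?sqr_ge0// expr1n ltW.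
have C1 : (c ^+ 2 - s ^+ 2) ^+ 2 + (2 * c * s) ^+ 2 = 1.
  by rewrite (_ : _ + _ = (c ^+ 2 + s ^+ 2) ^+ 2); [rewrite cs1 expr1n|ring].
have nC : `|c ^+ 2 - s ^+ 2| <= 1.
  rewrite -(ler_pXn2r (n := 2))// ?nnegrE// -normrX ger0_norm ?sqr_ge0// expr1n.
  by have := sqr_ge0 (2 * c * s); lra.
have nS : `|2 * c * s| <= 1.
  rewrite -(ler_pXn2r (n := 2))// ?nnegrE// -normrX ger0_norm ?sqr_ge0// expr1n.
  by have := sqr_ge0 (c ^+ 2 - s ^+ 2); lra.
have nbu : `|dot3 b u| <= 3 * (B * N).
  rewrite (_ : 3 * (B * N) = B * N + B * N + B * N); last by ring.
  rewrite (_ : dot3 b u = b.1.1 * u.1.1.2 + b.1.2 * u.1.2 + b.2 * u.2).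
    by do 2 ?[apply: normrD_le]; exact: normrM_le.
  by case: (u) => [[[]]].
have nl : `|ell e b u| <= N + 3 * (B * N).
  by apply: normrD_le => //; rewrite -[leRHS]mul1r; exact: normrM_le.
have hv := walk_var_corrector f cs1 s0 q1.
move: nbu nl na nz nx ny.
case: u uN => [[[a z] x] y] uN nbu nl /= na nz nx ny.
have hb := corrector_eq f z x y cs1 s0 q1.
rewrite -/b -/v in hv hb; cbv zeta in hb.
set C := c ^+ 2 - s ^+ 2 in nC C1 hb *; set S := 2 * c * s in nS C1 hb *.
set z1 := C * z - S * q * x in hb *.
have nz1 : `|z1| <= 2 * N.
  rewrite (_ : 2 * N = 1 * N + 1 * 1 * N); last by ring.
  apply: normrD_le; first exact: normrM_le.
  by rewrite normrN; apply: normrM_le => //; exact: normrM_le.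
set lam := expR _ in h4 *; set l := ell e b (a, z, x, y) in nl *.
clearbody b v z1.
(* An exact decomposition: [hb] cancels the first order in [e] and [hv] the second, so each of the
   six remaining terms has a factor of size e^3. *)
have -> : ell e b
     (cos e * a - sin e * z1, sin e * a + cos e * z1,
      cos f * (S * z + C * q * x) + sin f * (q * y),
      cos f * (q * y) - sin f * (S * z + C * q * x)) - lam * l =
  a * (cos e - 1 + e ^+ 2 / 2) + - (b.1.1 * a * e * (e - sin e))
  + (e - sin e) * z1 + e * b.1.1 * (cos e - 1) * z1
  + v * e ^+ 3 / 2 * dot3 b (a, z, x, y)
  + (1 - v * e ^+ 2 / 2 - lam) * l.
  rewrite /l /ell -hv; case: (b) hb => -[b1 b2] b3 /= hb.
  by rewrite -hb; field.
have n1 : `|a * (cos e - 1 + e ^+ 2 / 2)| <= N * e ^+ 3 by exact: normrM_le.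
have n2 : `|- (b.1.1 * a * e * (e - sin e))| <= B * N * 1 * e ^+ 3.
  by rewrite normrN; do 3 ?[apply: normrM_le => //].
have n3 : `|(e - sin e) * z1| <= e ^+ 3 * (2 * N) by exact: normrM_le.
have n4 : `|e * b.1.1 * (cos e - 1) * z1| <= e * B * e ^+ 2 * (2 * N).
  by do 3 ?[apply: normrM_le => //].
have n5 : `|v * e ^+ 3 / 2 * dot3 b (a, z, x, y)| <= v * e ^+ 3 * (3 * (B * N)).
  apply: normrM_le => //; rewrite ger0_norm; last first.
    by rewrite divr_ge0// mulr_ge0//; case/andP: e3.
  by have : 0 <= v * e ^+ 3 by [rewrite mulr_ge0//; case/andP: e3]; lra.
have n6 := normrM_le h4 nl.
rewrite (_ : K * e ^+ 3 = N * e ^+ 3 + B * N * 1 * e ^+ 3 + e ^+ 3 * (2 * N)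
  + e * B * e ^+ 2 * (2 * N) + v * e ^+ 3 * (3 * (B * N))
  + v ^+ 2 * e ^+ 3 * (N + 3 * (B * N))); last by rewrite /K; ring.
by do 5 ?[apply: normrD_le => //].
Qed.

Lemma iter_le_nonincreasing (T : Type) (R : realType) (f : T -> T) (g : T -> R)
    (x : T) (n : nat) :
  (forall y, g (f y) <= g y) -> g (iter n f x) <= g x.
Proof. by move=> fg; elim: n => //= n IH; exact: le_trans IH. Qed.

(** A telescoping argument: each step adds an error of at most [D], and multiplication by [lam] does
    not enlarge the errors already made. [P] is an invariant region where the one-step estimate is
    available. *)
Lemma iter_approx_eigen (T : Type) (R : realType) (f : T -> T) (P : T -> Prop)
    (l : T -> R) (lam D : R) (x : T) (t : nat) :
  `|lam| <= 1 -> P x -> (forall y, P y -> P (f y)) ->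
  (forall y, P y -> `|l (f y) - lam * l y| <= D) ->
  `|l (iter t f x) - lam ^+ t * l x| <= t%:R * D.
Proof.
move=> lam1 Px Pf fD.
have Pt n : P (iter n f x) by elim: n => //= n; exact: Pf.
elim: t => [|t IH]; first by rewrite expr0 mul1r subrr normr0 mul0r.
rewrite [X in `|X|](_ : _ = (l (f (iter t f x)) - lam * l (iter t f x))
    + lam * (l (iter t f x) - lam ^+ t * l x)); last first.
  by rewrite /= exprS; ring.
rewrite -natr1 mulrDl mul1r addrC; apply: normrD_le.
  by rewrite -[leRHS]mul1r; exact: normrM_le.
exact: fD.
Qed.

Lemma cvg_invsqrt (R : realType) (a : R) :
  a / Num.sqrt (n%:R : R) @[n --> \oo] --> (0 : R).
Proof.
have : (Num.sqrt (n%:R : R))^-1 @[n --> \oo] --> (0 : R).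
  apply/gtr0_cvgV0.
    by near=> n; rewrite sqrtr_gt0 ltr0n; near: n; exact: nbhs_infty_gt.
  apply/cvgryPge => A; near=> n.
  rewrite (le_trans (ler_norm A))// -sqrtr_sqr ler_wsqrtr//.
  by near: n; exact: nbhs_infty_ger.
by move=> h; rewrite -(mulr0 a); exact: cvgMl_tmp.
Unshelve. all: by end_near. Qed.

(** With e = nu / sqrt t, the t errors of size K e^3 add up to K nu^3 / sqrt t. Replacing [ell] by
    the trace coordinate at times 0 and t costs O(e) more. *)
Lemma bloch_iter_cvg (R : realType) (q c s f nu : R) (u : R * R * R * R) :
  c ^+ 2 + s ^+ 2 = 1 -> s != 0 -> q ^+ 2 < 1 -> 0 <= nu ->
  (iter t (bloch_step q c s f (nu / Num.sqrt t%:R)) u).1.1.1 @[t --> \oo] -->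
  expR (- (walk_var q c s f * nu ^+ 2 / 2)) * u.1.1.1.
Proof.
move=> cs1 s0 q1 nu0.
set v := walk_var q c s f.
have v0 : 0 <= v by exact: walk_var_ge0.
pose b := corrector q c s f.
pose B := `|b.1.1| + `|b.1.2| + `|b.2|.
(* This radius satisfies [bloch_norm2 u <= N ^+ 2] without a square root. *)
pose N := 1 + bloch_norm2 u.
have un0 : 0 <= bloch_norm2 u.
  by case: (u) => [[[a z] x] y] /=; rewrite !addr_ge0 ?sqr_ge0.
have N1 : 1 <= N by rewrite /N; lra.
have N0 : 0 <= N by lra.
have uN : bloch_norm2 u <= N ^+ 2 by rewrite /N; nra.
have [] := @ell_step_error R q c s f B N cs1 s0 q1 N0.
- by rewrite -/b /B; have := normr_ge0 b.1.2; have := normr_ge0 b.2; lra.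
- by rewrite -/b /B; have := normr_ge0 b.1.1; have := normr_ge0 b.2; lra.
- by rewrite -/b /B; have := normr_ge0 b.1.1; have := normr_ge0 b.1.2; lra.
rewrite -/v -/b => K K0 HK.
(* The total error is Q / sqrt t: the first term collects the t steps, the second the correction
   part of [ell] at both ends of the orbit. *)
pose Q := K * nu ^+ 3 + 2 * (nu * (3 * (B * N))).
apply: cvg_sub0; last exact: cvg_cst.
apply: (@squeeze_cvgr _ _ _ _ (fun t => - (Q / Num.sqrt t%:R))
  (fun t => Q / Num.sqrt t%:R)); last 2 first.
- by rewrite -oppr0; apply: cvgN; exact: cvg_invsqrt.
- exact: cvg_invsqrt.
near=> t.
rewrite -ler_norml /=.
set e := nu / Num.sqrt t%:R.
have t0 : 0 < Num.sqrt t%:R :> R.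
  by rewrite sqrtr_gt0 ltr0n; near: t; exact: nbhs_infty_gt.
have e01 : 0 <= e <= 1.
  rewrite divr_ge0 ?sqrtr_ge0//= ler_pdivrMr// mul1r.
  rewrite -[leLHS]ger0_norm// -sqrtr_sqr ler_wsqrtr//.
  by near: t; exact: nbhs_infty_ger.
have te2 : t%:R * e ^+ 2 = nu ^+ 2.
  rewrite -[X in X * _](sqr_sqrtr (ler0n R t)) /e expr_div_n.
  by field; rewrite gt_eqF.
have te3 : t%:R * (K * e ^+ 3) = K * nu ^+ 3 / Num.sqrt t%:R.
  rewrite (_ : _ * _ = K * (t%:R * e ^+ 2) * e); last by ring.
  by rewrite te2 /e; field; rewrite gt_eqF.
set lam := expR (- (v * e ^+ 2 / 2)).
(* Since t e^2 = nu^2, the limit is exactly the t-th power of the one-step factor. *)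
have lamt : expR (- (v * nu ^+ 2 / 2)) = lam ^+ t.
  by rewrite /lam -expRM_natl -te2; congr expR; rewrite -mulr_natl; ring.
have lam1 : `|lam| <= 1.
  rewrite ger0_norm ?expR_ge0// -expR0 ler_expR oppr_le0.
  by rewrite divr_ge0// mulr_ge0// sqr_ge0.
have hdot w : bloch_norm2 w <= N ^+ 2 -> `|e * dot3 b w| <= e * (3 * (B * N)).
  move=> wN; have [na nz nx ny] := bloch_coord_le N0 wN.
  case/andP: e01 => e0 e1; apply: normrM_le; first by rewrite ger0_norm.
  rewrite (_ : 3 * (B * N) = B * N + B * N + B * N); last by ring.
  rewrite (_ : dot3 b w = b.1.1 * w.1.1.2 + b.1.2 * w.1.2 + b.2 * w.2); last first.
    by case: (w) => [[[]]].
  do 2 ?[apply: normrD_le]; apply: normrM_le => //; rewrite /B.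
  - by have := normr_ge0 b.1.2; have := normr_ge0 b.2; lra.
  - by have := normr_ge0 b.1.1; have := normr_ge0 b.2; lra.
  - by have := normr_ge0 b.1.1; have := normr_ge0 b.1.2; lra.
have stepN w : bloch_norm2 w <= N ^+ 2 -> bloch_norm2 (bloch_step q c s f e w) <= N ^+ 2.
  by apply: le_trans; apply: bloch_step_contract => //; exact: ltW.
have := @iter_approx_eigen _ _ (bloch_step q c s f e)
  (fun w => bloch_norm2 w <= N ^+ 2) (ell e b) lam _ u t lam1 uN stepN
  (fun w wN => HK e w e01 wN).
have utN : bloch_norm2 (iter t (bloch_step q c s f e) u) <= N ^+ 2.
  apply: le_trans uN; apply: iter_le_nonincreasing => w.
  by apply: bloch_step_contract => //; exact: ltW.
have d1 := hdot _ utN; have d0 := hdot _ uN.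
have lamt1 : `|lam ^+ t| <= 1 by rewrite normrX exprn_ile1.
have d0' := normrM_le lamt1 d0.
rewrite te3 lamt => dt.
rewrite [X in `|X|](_ : _ = ell e b (iter t (bloch_step q c s f e) u)
    - lam ^+ t * ell e b u + lam ^+ t * (e * dot3 b u)
    + - (e * dot3 b (iter t (bloch_step q c s f e) u))); last first.
  by rewrite /ell !fctE; ring.
rewrite (_ : Q / Num.sqrt t%:R = K * nu ^+ 3 / Num.sqrt t%:R
   + 1 * (e * (3 * (B * N))) + e * (3 * (B * N))); last first.
  by rewrite /Q /e; ring.
by apply: normrD_le; [exact: normrD_le | rewrite normrN].
Unshelve. all: by end_near. Qed.

(** * Blocks of the walk operators *)

(** A finitary sum with infinite support is 0 by default, so both supports have to be finite
    here. *)
Lemma fsum_additive (V : zmodType) (f g : int -> V) :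
  finite_set [set x | f x != 0] -> finite_set [set x | g x != 0] ->
  \sum_(x \in [set: int]) (f x + g x) =
  \sum_(x \in [set: int]) f x + \sum_(x \in [set: int]) g x.
Proof.
move=> ff fg; set A := [set x | f x != 0] `|` [set x | g x != 0].
have fA : finite_set A by rewrite finite_setU.
have A0 h : (forall x, ~ A x -> h x = 0) ->
    \sum_(x \in [set: int]) h x = \sum_(x \in A) h x :> V.
  by move=> h0; symmetry; apply: fsbig_widen => // x [_]; exact: h0.
have f0 x : ~ A x -> f x = 0.
  by move=> nA; apply/eqP; apply: contra_notT nA => ?; left.
have g0 x : ~ A x -> g x = 0.
  by move=> nA; apply/eqP; apply: contra_notT nA => ?; right.
rewrite !A0 ?fsbig_split// => x nA.
by rewrite f0// g0// addr0.
Qed.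

Lemma fsum_single (V : zmodType) (f : int -> V) (a : int) :
  (forall x, x != a -> f x = 0) -> \sum_(x \in [set: int]) f x = f a.
Proof.
move=> f0; rewrite -(fsbig_widen [set a]) ?fsbig_set1//.
by move=> x [_ /= xa]; apply: f0; exact/eqP.
Qed.

Section WalkOperators.
Variable R : realType.
Local Notation C := R[i].
Implicit Types (U A : 'M[C]_2) (M : walk_op R) (x y : int).

Lemma op_mul_idr M A x y : op_mul M (tensor (id_pos R) A) x y = M x y *m A.
Proof.
rewrite /op_mul /tensor /id_pos (fsum_single (a := y)) ?eqxx ?scale1r//.
by move=> z /negbTE ->; rewrite scale0r mulmx0.
Qed.

Lemma op_adj_id A : op_adj (tensor (id_pos R) A) = tensor (id_pos R) (A ^t*).
Proof.
apply/funext => x; apply/funext => y; rewrite /op_adj /tensor /id_pos eq_sym.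
by case: eqP => _; rewrite ?scale1r// !scale0r trmx0 map_mx0.
Qed.

Lemma evolE U x y :
  evol U x y = ((x == y + 1)%:R *: PR R + (x == y - 1)%:R *: PL R) *m U.
Proof. by rewrite /evol op_mul_idr. Qed.

(** Finiteness of the support is delivered with the value, because [fsum_additive] asks for it when
    the two shifts are added. *)
Lemma fsum_pred_scale (V : lmodType C) (P : pred int) (f : int -> V) (a : int) :
  (forall z, P z = (z == a)) ->
  finite_set [set z | (P z)%:R *: f z != 0] /\
  \sum_(z \in [set: int]) (P z)%:R *: f z = f a.
Proof.
move=> Pa; split.
  apply: (@sub_finite_set _ _ [set a]) => // z /=; rewrite Pa.
  by case: (eqVneq z a) => [->//|_]; rewrite scale0r eqxx.
rewrite (fsum_single (a := a)) ?Pa ?eqxx ?scale1r// => z.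
by rewrite Pa => /negbTE ->; rewrite scale0r.
Qed.

Lemma eq_addr_sub x y : (x == y + 1) = (y == x - 1).
Proof. by rewrite -subr_eq eq_sym. Qed.

Lemma eq_subr_add x y : (x == y - 1) = (y == x + 1).
Proof. by rewrite eq_sym subr_eq. Qed.

Lemma op_mul_evol U M x y :
  op_mul (evol U) M x y =
  PR R *m U *m M (x - 1) y + PL R *m U *m M (x + 1) y.
Proof.
have E z : evol U x z *m M z y = (x == z + 1)%:R *: (PR R *m U *m M z y)
    + (x == z - 1)%:R *: (PL R *m U *m M z y).
  by rewrite evolE !mulmxDl !scalemxAl.
rewrite /op_mul (eq_fsbigr _ _ (fun z _ => E z)).
have [f1 e1] := @fsum_pred_scale _ (fun z => x == z + 1)
  (fun z => PR R *m U *m M z y) (x - 1) (eq_addr_sub _).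
have [f2 e2] := @fsum_pred_scale _ (fun z => x == z - 1)
  (fun z => PL R *m U *m M z y) (x + 1) (eq_subr_add _).
exact: etrans (fsum_additive f1 f2) (congr2 +%R e1 e2).
Qed.

Lemma adjmxM m n k (A : 'M[C]_(m, n)) (B : 'M[C]_(n, k)) :
  (A *m B) ^t* = B ^t* *m A ^t*.
Proof. by rewrite trmx_mul map_mxM. Qed.

Lemma adjmxD m n (A B : 'M[C]_(m, n)) : (A + B) ^t* = A ^t* + B ^t*.
Proof. by rewrite linearD map_mxD. Qed.

Lemma adjmx_natZ m n k (A : 'M[C]_(m, n)) : (k%:R *: A) ^t* = k%:R *: A ^t*.
Proof. by rewrite linearZ map_mxZ rmorph_nat. Qed.

Lemma op_mul_adj_evol U M x y :
  op_mul M (op_adj (evol U)) x y =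
  M x (y - 1) *m (PR R *m U) ^t* + M x (y + 1) *m (PL R *m U) ^t*.
Proof.
have E z : M x z *m op_adj (evol U) z y =
    (y == z + 1)%:R *: (M x z *m (PR R *m U) ^t*)
    + (y == z - 1)%:R *: (M x z *m (PL R *m U) ^t*).
  rewrite /op_adj evolE mulmxDl.
  rewrite adjmxD mulmxDr -2!scalemxAl.
  by congr (_ + _); rewrite [RHS]scalemxAr; congr (_ *m _); exact: adjmx_natZ.
rewrite /op_mul (eq_fsbigr _ _ (fun z _ => E z)).
have [f1 e1] := @fsum_pred_scale _ (fun z => y == z + 1)
  (fun z => M x z *m (PR R *m U) ^t*) (y - 1) (eq_addr_sub _).
have [f2 e2] := @fsum_pred_scale _ (fun z => y == z - 1)
  (fun z => M x z *m (PL R *m U) ^t*) (y + 1) (eq_subr_add _).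
exact: etrans (fsum_additive f1 f2) (congr2 +%R e1 e2).
Qed.

Definition shift (i : 'I_2) : int := if i == 0 then 1 else - 1.

Definition coin_map U (p : R) (X : 'M[C]_2) : 'M[C]_2 :=
  \sum_(n < 3) (U *m measA p n) *m X *m (U *m measA p n) ^t*.

Lemma PRE i j : PR R i j = ((i == 0) && (j == 0))%:R.
Proof.
rewrite /PR /ketR !mxE big_ord1 !mxE eqxx !andbT /= conjC_nat.
by rewrite -natrM mulnb.
Qed.

Lemma PLE i j : PL R i j = ((i == 1) && (j == 1))%:R.
Proof.
rewrite /PL /ketL !mxE big_ord1 !mxE eqxx !andbT /= conjC_nat.
by rewrite -natrM mulnb.
Qed.

Lemma addmxE m n (A B : 'M[C]_(m, n)) i j : (A + B) i j = A i j + B i j.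
Proof. by rewrite mxE. Qed.

Lemma scalemxE m n c (A : 'M[C]_(m, n)) i j : (c *: A) i j = c * A i j.
Proof. by rewrite mxE. Qed.

Lemma lin3mxE m n a b c (X Y Z : 'M[C]_(m, n)) i j :
  (a *: X + b *: Y + c *: Z) i j = a * X i j + b * Y i j + c * Z i j.
Proof. by rewrite !mxE. Qed.

Lemma PR_mulE (X : 'M[C]_2) i j : (PR R *m X) i j = (i == 0)%:R * X 0 j.
Proof.
by rewrite mxE !big_ord_recl big_ord0 !PRE /= andbT andbF mul0r !addr0.
Qed.

Lemma PL_mulE (X : 'M[C]_2) i j : (PL R *m X) i j = (i == 1)%:R * X 1 j.
Proof.
rewrite mxE !big_ord_recl big_ord0 !PLE /= andbT andbF mul0r add0r addr0.
by congr (_ * X _ _); apply/val_inj.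
Qed.

Lemma mul_PRE (X : 'M[C]_2) i j : (X *m (PR R) ^t*) i j = X i 0 * (j == 0)%:R.
Proof.
by rewrite mxE !big_ord_recl big_ord0 ![map_mx _ _ _ _]mxE ![_^T _ _]mxE
  !PRE /= !conjC_nat andbT andbF mulr0 !addr0.
Qed.

Lemma mul_PLE (X : 'M[C]_2) i j : (X *m (PL R) ^t*) i j = X i 1 * (j == 1)%:R.
Proof.
rewrite mxE !big_ord_recl big_ord0 ![map_mx _ _ _ _]mxE ![_^T _ _]mxE
  !PLE /= !conjC_nat andbT andbF mulr0 add0r addr0.
by congr (X _ _ * _); apply/val_inj.
Qed.

Lemma ord2_eq (i : 'I_2) : i = 0 \/ i = 1.
Proof.
case: i => [[|[|//]] h]; [left|right]; exact/val_inj.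
Qed.

(** The left projections select by row and the right ones by column, so exactly one of the four
    terms contributes to a given entry. *)
Lemma sandwichE (Y1 Y2 Y3 Y4 B : 'M[C]_2) i j :
  ((PR R *m Y1 + PL R *m Y2) *m B *m (PR R) ^t* +
   (PR R *m Y3 + PL R *m Y4) *m B *m (PL R) ^t*) i j =
  ((if j == 0 then if i == 0 then Y1 else Y2 else if i == 0 then Y3 else Y4) *m B) i j.
Proof.
rewrite addmxE.
apply: (etrans (congr2 +%R (mul_PRE _ i j) (mul_PLE _ i j))).
have G (Y Z : 'M[C]_2) k l : ((PR R *m Y + PL R *m Z) *m B) k l =
    (k == 0)%:R * (Y *m B) 0 l + (k == 1)%:R * (Z *m B) 1 l.
  by rewrite mulmxDl -(mulmxA (PR R)) -(mulmxA (PL R)) [LHS]mxE PR_mulE PL_mulE.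
rewrite (G Y1 Y2) (G Y3 Y4).
by have [->|->] := ord2_eq i; have [->|->] := ord2_eq j;
  rewrite /= ?(mul1r, mul0r, mulr1, mulr0, addr0, add0r).
Qed.

(** The conditional shift follows the coin, so row [i] and column [j] fix the displacements of the
    two positions. Each entry of a new block then depends on a single old block. *)
Lemma stepE U p M x y i j :
  step U p M x y i j = coin_map U p (M (x - shift i) (y - shift j)) i j.
Proof.
rewrite /step /coin_map !summxE; apply: eq_bigr => n _.
rewrite op_mul_adj_evol op_adj_id !op_mul_idr.
(* A measurement operator acts on the coin alone and can be absorbed into [U], giving the evolution
   with coin [U *m measA p n]. *)
have E z w : op_mul (op_mul (evol U) (tensor (id_pos R) (measA p n))) M z w =
    PR R *m (U *m measA p n *m M (z - 1) w) +
    PL R *m (U *m measA p n *m M (z + 1) w).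
  have -> : op_mul (evol U) (tensor (id_pos R) (measA p n)) = evol (U *m measA p n).
    apply/funext => a; apply/funext => b; rewrite op_mul_idr !evolE.
    by rewrite mulmxA.
  by rewrite op_mul_evol !mulmxA.
have F (Y P A : 'M[C]_2) : Y *m A ^t* *m (P *m U) ^t* = Y *m (U *m A) ^t* *m P ^t*.
  by rewrite !adjmxM !mulmxA.
rewrite 2!E.
apply: (etrans (congr1 (fun A : 'M[C]_2 => A i j) (congr2 +%R (F _ _ _) (F _ _ _)))).
rewrite (sandwichE _ _ _ _ _ i j).
rewrite /shift.
by have [->|->] := ord2_eq i; have [->|->] := ord2_eq j; rewrite /= ?opprK.
Qed.

(** Dephasing: A_0 keeps every entry with weight 1 - p, while A_1 and A_2 restore weight p on the
    diagonal only. The coin is real, so its adjoint is its transpose. *)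
Lemma coin_mapE (a b c d p : R) (X : 'M[C]_2) i j :
  0 <= p <= 1 ->
  let D := \matrix_(k, l) (if k == l then X k l else (1 - p)%:C * X k l) in
  let U := mxC (mx2 a b c d) in
  coin_map U p X i j = (U *m D *m U^T) i j.
Proof.
move=> p01 D U.
have UT A : (U *m A)^t* = A ^t* *m U^T.
  rewrite adjmxM; congr (_ *m _); apply/matrixP => k l; rewrite !mxE.
  exact: conjc_real.
have -> : coin_map U p X = U *m (\sum_(n < 3) measA p n *m X *m (measA p n) ^t*) *m U^T.
  rewrite /coin_map mulmx_sumr mulmx_suml; apply: eq_bigr => n _.
  by rewrite UT !mulmxA.
congr ((_ *m _ *m _) i j).
have S r : 0 <= r -> (Num.sqrt r)%:C * (Num.sqrt r)%:C = r%:C.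
  by move=> r0; rewrite -rmorphM -expr2 sqr_sqrtr.
have [p0 p1] : 0 <= p /\ 0 <= 1 - p by move: p01 => /andP[? ?]; split; lra.
have proj r (A : 'M[C]_2) : 0 <= r ->
    ((Num.sqrt r)%:C *: A) *m X *m ((Num.sqrt r)%:C *: A) ^t* = r%:C *: (A *m X *m A ^t*).
  move=> r0; have -> : ((Num.sqrt r)%:C *: A) ^t* = (Num.sqrt r)%:C *: A ^t*.
    rewrite linearZ map_mxZ; congr (_ *: _); exact: conjc_real.
  by rewrite -!scalemxAl -scalemxAr scalerA S.
have -> : \sum_(n < 3) measA p n *m X *m (measA p n) ^t* =
    (1 - p)%:C *: X + p%:C *: (PR R *m X *m (PR R) ^t*) + p%:C *: (PL R *m X *m (PL R) ^t*).
  rewrite 3!big_ord_recl big_ord0 [X in _ + (_ + X)]addr0 [LHS]addrA.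
  congr (_ + _ + _); [|exact: proj|exact: proj].
  rewrite {1 2}/measA /= -scalemx1 (proj _ _ p1).
  by rewrite mul1mx trmx1 map_mx1 mulmx1.
apply/matrixP => k l.
apply: (etrans (lin3mxE _ _ _ _ _ _ k l)).
apply: (etrans (congr2 +%R (congr2 +%R erefl (congr1 _ (mul_PRE _ k l)))
  (congr1 _ (mul_PLE _ k l)))).
rewrite [RHS]mxE PR_mulE PL_mulE.
(* Only the scalar [(1 - p)%:C] is left as an atom for [ring]. *)
have -> : p%:C = 1 - (1 - p)%:C :> C
  by rewrite -(rmorph1 (real_complex R)) -rmorphB /= opprB addrC subrK.
by have [->|->] := ord2_eq k; have [->|->] := ord2_eq l; rewrite /=; ring.
Qed.

End WalkOperators.

(** * Averages over the momentum *)

Section FourierMean.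
Variable R : realType.
Local Notation C := R[i].
Local Notation mu := (@lebesgue_measure R).

Definition fourier_mean (f : R -> R) : R :=
  (2 * pi)^-1 * \int[mu]_(k in `[0, 2 * pi]) f k.

Definition cmean (f : R -> C) : C :=
  fourier_mean (fun k => complex.Re (f k)) +i* fourier_mean (fun k => complex.Im (f k)).

Definition ccont (f : R -> C) : Prop :=
  continuous (fun k => complex.Re (f k)) /\ continuous (fun k => complex.Im (f k)).

Lemma integrable_period (f : R -> R) :
  continuous f -> mu.-integrable `[0, 2 * pi] (EFin \o f).
Proof.
move=> cf; apply: continuous_compact_integrable; first exact: segment_compact.
exact: continuous_subspaceT.
Qed.

Lemma fourier_meanD (f g : R -> R) : continuous f -> continuous g ->
  fourier_mean (fun k => f k + g k) = fourier_mean f + fourier_mean g.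
Proof.
move=> cf cg; rewrite /fourier_mean RintegralD//; first exact: mulrDr.
  exact: integrable_period.
exact: integrable_period.
Qed.

Lemma fourier_meanZ (c : R) (f : R -> R) : continuous f ->
  fourier_mean (fun k => c * f k) = c * fourier_mean f.
Proof.
move=> cf; rewrite /fourier_mean RintegralZl//; first exact: mulrCA.
exact: integrable_period.
Qed.

Lemma continuousD_fun (f g : R -> R) : continuous f -> continuous g ->
  continuous (fun k => f k + g k).
Proof. by move=> cf cg x; apply: cvgD; [exact: cf|exact: cg]. Qed.

Lemma continuousM_fun (f g : R -> R) : continuous f -> continuous g ->
  continuous (fun k => f k * g k).
Proof. by move=> cf cg x; apply: cvgM; [exact: cf|exact: cg]. Qed.

Lemma continuousN_fun (f : R -> R) : continuous f -> continuous (fun k => - f k).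
Proof. by move=> cf x; apply: cvgN; exact: cf. Qed.

Lemma continuous_cst_fun (c : R) : continuous (fun _ : R => c).
Proof. by move=> x; exact: cvg_cst. Qed.

Lemma ReD (x y : C) : complex.Re (x + y) = complex.Re x + complex.Re y.
Proof. by case: x; case: y. Qed.

Lemma ImD (x y : C) : complex.Im (x + y) = complex.Im x + complex.Im y.
Proof. by case: x; case: y. Qed.

Lemma ReM (x y : C) : complex.Re (x * y) =
  complex.Re x * complex.Re y + - (complex.Im x * complex.Im y).
Proof. by case: x; case: y. Qed.

Lemma ImM (x y : C) : complex.Im (x * y) =
  complex.Re x * complex.Im y + complex.Im x * complex.Re y.
Proof. by case: x; case: y. Qed.

Lemma ccontD f g : ccont f -> ccont g -> ccont (fun k => f k + g k).
Proof.
move=> [f1 f2] [g1 g2]; split.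
  under eq_fun do rewrite ReD; exact: continuousD_fun.
under eq_fun do rewrite ImD; exact: continuousD_fun.
Qed.

Lemma ccontM f g : ccont f -> ccont g -> ccont (fun k => f k * g k).
Proof.
move=> [f1 f2] [g1 g2]; split.
  under eq_fun do rewrite ReM; apply: continuousD_fun; first exact: continuousM_fun.
  by apply: continuousN_fun; exact: continuousM_fun.
by under eq_fun do rewrite ImM; apply: continuousD_fun; exact: continuousM_fun.
Qed.

Lemma ccont_cst (c : C) : ccont (fun => c).
Proof. by split; exact: continuous_cst_fun. Qed.

Lemma ccont_cis (f : R -> R) : continuous f -> ccont (fun k => cis (f k)).
Proof.
move=> cf; split => x /=.
  by apply: continuous_comp; [exact: cf|exact: continuous_cos].
by apply: continuous_comp; [exact: cf|exact: continuous_sin].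
Qed.

Lemma cmeanD f g : ccont f -> ccont g ->
  cmean (fun k => f k + g k) = cmean f + cmean g.
Proof.
move=> [f1 f2] [g1 g2]; rewrite /cmean.
under [in fourier_mean (fun k => complex.Re (f k + g k))]eq_fun do rewrite ReD.
under [in fourier_mean (fun k => complex.Im (f k + g k))]eq_fun do rewrite ImD.
by rewrite !fourier_meanD.
Qed.

Lemma cmeanZ c f : ccont f -> cmean (fun k => c * f k) = c * cmean f.
Proof.
move=> [f1 f2]; rewrite /cmean.
under [in fourier_mean (fun k => complex.Re (c * f k))]eq_fun do rewrite ReM -mulNr.
under [in fourier_mean (fun k => complex.Im (c * f k))]eq_fun do rewrite ImM.
rewrite !fourier_meanD ?fourier_meanZ//;
  do ?[by apply: continuousM_fun => //; exact: continuous_cst_fun].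
by case: c => a b; rewrite /= mulNr.
Qed.

Lemma ccont_sum (I : Type) (r : seq I) (f : I -> R -> C) :
  (forall i, ccont (f i)) -> ccont (fun k => \sum_(i <- r) f i k).
Proof.
move=> cf; elim: r => [|i r IH].
  by under eq_fun do rewrite big_nil; exact: ccont_cst.
by under eq_fun do rewrite big_cons; exact: ccontD.
Qed.

Lemma cmean_sum (I : Type) (r : seq I) (f : I -> R -> C) :
  (forall i, ccont (f i)) ->
  cmean (fun k => \sum_(i <- r) f i k) = \sum_(i <- r) cmean (f i).
Proof.
move=> cf; elim: r => [|i r IH].
  under eq_fun do rewrite big_nil; rewrite big_nil.
  rewrite -[RHS](mul0r (cmean (fun=> 0))) -cmeanZ; last exact: ccont_cst.
  by congr cmean; apply/funext => k; rewrite mul0r.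
under eq_fun do rewrite big_cons.
rewrite cmeanD ?IH ?big_cons//; exact: ccont_sum.
Qed.

Lemma cis0 : cis (0 : R) = 1.
Proof. by rewrite /cis cos0 sin0. Qed.

Lemma cisD (a b : R) : cis (a + b) = cis a * cis b.
Proof. by rewrite /cis cosD sinD /GRing.mul /= [sin a * _ + _]addrC. Qed.

Lemma fourier_mean_cst (c : R) : fourier_mean (fun=> c) = c.
Proof.
have pi0 := pi_gt0 R.
rewrite /fourier_mean Rintegral_cst//= lebesgue_measure_itv/=.
rewrite lte_fin mulr_gt0//= oppr0 addr0.
by rewrite mulrCA mulVf ?mulr1// gt_eqF// mulr_gt0.
Qed.

Lemma periodic_intmul (f : R -> R) (T : R) :
  periodic f T -> forall (n : int) a, f (a + T *~ n) = f a.
Proof.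
move=> fT [n|n] a; first exact: periodicn.
by rewrite NegzE mulrNz -(periodicn fT n.+1 (a - _)) subrK.
Qed.

(** Orthogonality of the characters. For nonzero [m] the primitives are sines and cosines divided by
    [m], which agree at 0 and 2 pi by periodicity, whatever the offset [al]. *)
Lemma cmean_cis (m : int) (al : R) :
  cmean (fun k => cis (- (m%:~R * (k + al)))) = (m == 0)%:R.
Proof.
have [->|m0] := eqVneq m 0.
  under eq_fun do rewrite mulr0z mul0r oppr0 cis0.
  by rewrite /cmean !fourier_mean_cst.
have pi0 := pi_gt0 R.
have m0' : m%:~R != 0 :> R by rewrite intr_eq0.
have period : - (m%:~R * (2 * pi + al)) = - (m%:~R * (0 + al)) + (pi *+ 2) *~ (- m) :> R.
  by rewrite -mulrzl mulrNz -[pi *+ 2]mulr_natl; ring.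
have dlin x : is_derive x (1 : R) (fun k : R => - (m%:~R * (k + al))) (- m%:~R).
  by apply: is_derive_eq; rewrite /GRing.scale /=; ring.
have ftc (f F : R -> R) : continuous f -> (forall x : R, is_derive x (1 : R) F (f x)) ->
    F (2 * pi) = F 0 -> fourier_mean f = 0.
  move=> cf dF F2pi.
  have cF : continuous F.
    move=> y; apply/differentiable_continuous/derivable1_diffP.
    exact: (@ex_derive _ _ _ _ _ _ _ (dF y)).
  rewrite /fourier_mean /Rintegral (@continuous_FTC2 _ _ F).
  - by rewrite F2pi subee// mulr0.
  - by rewrite mulr_gt0.
  - exact: continuous_subspaceT.
  - split.
    + by move=> x _; exact: (@ex_derive _ _ _ _ _ _ _ (dF x)).
    + exact: cvg_at_right_filter (cF _).
    + exact: cvg_at_left_filter (cF _).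
  - by move=> x _; rewrite derive1E (@derive_val _ _ _ _ _ _ _ (dF x)).
have clin : continuous (fun k : R => - (m%:~R * (k + al))).
  move=> y; apply/differentiable_continuous/derivable1_diffP.
  exact: (@ex_derive _ _ _ _ _ _ _ (dlin y)).
have [c1 c2] := ccont_cis clin.
rewrite /cmean /cis /=.
have d1 x : is_derive x (1 : R) (fun k => - (m%:~R)^-1 * sin (- (m%:~R * (k + al))))
    (cos (- (m%:~R * (x + al)))).
  by apply: is_derive_eq; rewrite /GRing.scale /=; field.
have d2 x : is_derive x (1 : R) (fun k => (m%:~R)^-1 * cos (- (m%:~R * (k + al))))
    (sin (- (m%:~R * (x + al)))).
  by apply: is_derive_eq; rewrite /GRing.scale /=; field.
rewrite (ftc _ _ c1 d1) ?(ftc _ _ c2 d2)//.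
- rewrite period; congr (_ * _); exact: (periodic_intmul (@cosD2pi R)).
- rewrite period; congr (_ * _); exact: (periodic_intmul (@sinD2pi R)).
Qed.

End FourierMean.

(** * Modes of the state *)

(** Both sums are restricted to the support of [f], which contains that of the image. *)
Lemma fsum_morph (V W : zmodType) (phi : V -> W) (f : int -> V) :
  {morph phi : x y / x + y} -> finite_set [set x | f x != 0] ->
  phi (\sum_(x \in [set: int]) f x) = \sum_(x \in [set: int]) phi (f x).
Proof.
move=> phiD ff; set A := [set x | f x != 0] in ff.
have f0 x : ~ A x -> f x = 0 by move=> nA; apply/eqP; apply: contra_notT nA.
have phi0 : phi 0 = 0 by apply: (addrI (phi 0)); rewrite -phiD !addr0.
rewrite -(fsbig_widen A) => [|//|x [_ /f0//]].
rewrite -(fsbig_widen A) => [|//|x [_ /f0 /= ->]]; last by rewrite phi0.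
by rewrite !fsbig_finite//; exact: big_morph.
Qed.

Section Mode.
Variable R : realType.
Local Notation C := R[i].

Implicit Types (U : 'M[C]_2) (Phi : 'cV[C]_2).

(** Explicit coefficients of [coin_map] as a linear map on entries, so that it commutes with sums
    over positions and with means over the momentum by linearity alone. *)
Definition coin_coef (a b c d p : R) (i j k l : 'I_2) : C :=
  let U := mxC (mx2 a b c d) in
  U i k * U j l * (if k == l then 1 else (1 - p)%:C).

Lemma coin_map_coef (a b c d p : R) (X : 'M[C]_2) i j : 0 <= p <= 1 ->
  coin_map (mxC (mx2 a b c d)) p X i j =
  \sum_k \sum_l coin_coef a b c d p i j k l * X k l.
Proof.
move=> p01; rewrite coin_mapE// mxE exchange_big /=; apply: eq_bigr => l _.
rewrite mxE mulr_suml; apply: eq_bigr => k _.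
rewrite /coin_coef [X in _ * X * _]mxE [X in _ * X = _]mxE; case: eqP => _; ring.
Qed.

Lemma coin_map0 U p : coin_map U p 0 = 0.
Proof. by rewrite /coin_map big1// => n _; rewrite mulmx0 mul0mx. Qed.

(** Propagation by one site per step. This makes all the finitary sums over positions genuine finite
    sums. *)
Lemma rho_support U p Phi t x y :
  (t%:Z < `|x|) || (t%:Z < `|y|) -> rho U p Phi t x y = 0.
Proof.
rewrite /rho; elim: t x y => [|t IH] x y xy.
  rewrite /= /rho0 /tensor /proj_pos; move: xy; rewrite !normr_gt0.
  by case: (x =P 0) => _; case: (y =P 0) => _ //= _; rewrite scale0r.
apply/matrixP => i j; rewrite iterS stepE IH ?coin_map0 ?mxE//.
move: xy; rewrite /shift; case: (i == 0); case: (j == 0); lia.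
Qed.

Lemma finite_int_ball (t : int) : finite_set [set x : int | `|x| <= t].
Proof.
apply: (@sub_finite_set _ _ ((fun n : nat => n%:Z - t) @` `I_(`|t|.*2.+1))).
  move=> x /= xt; exists (absz (x + t)) => /=; lia.
exact/finite_image/finite_II.
Qed.

(* Using x + m and x - m keeps only even relative positions, where the state lives. *)
Definition mode U p Phi (nu : R) t (m : int) : 'M[C]_2 :=
  \sum_(x \in [set: int]) cis (nu * x%:~R) *: rho U p Phi t (x + m) (x - m).

Lemma mode_support U p Phi (nu : R) t m :
  finite_set [set x | cis (nu * x%:~R) *: rho U p Phi t (x + m) (x - m) != 0].
Proof.
apply: (@sub_finite_set _ _ [set x : int | `|x| <= t%:Z + `|m|]).
  move=> x /=; apply: contra_neqT => xt.
  rewrite rho_support ?scaler0//; lia.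
exact: finite_int_ball.
Qed.

Lemma Phat_mode U p Phi nu t : Phat U p Phi nu t = \tr (mode U p Phi nu t 0).
Proof.
rewrite /mode (fsum_morph (@mxtraceD _ _) (mode_support _ _ _ _ _ _)).
apply: eq_fsbigr => x _; rewrite addr0 ?subr0 linearZ /=; congr (_ * _).
rewrite /prob /op_tr.
have E z : op_mul (tensor (proj_pos R x) 1%:M) (rho U p Phi t) z z =
    (z == x)%:R *: rho U p Phi t z z.
  rewrite /op_mul (fsum_single (a := x)) /tensor /proj_pos.
    by rewrite eqxx andbT -scalemxAl mul1mx; case: eqP => [->|]; rewrite ?scale0r.
  by move=> y /negbTE ->; rewrite andbF scale0r mul0mx.
rewrite (fsum_single (a := x)) ?E ?eqxx ?scale1r// => z.
by rewrite E => /negbTE ->; rewrite scale0r mxtrace0.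
Qed.

Lemma mode0 U p Phi nu m :
  mode U p Phi nu 0 m = (m == 0)%:R *: (Phi *m Phi ^t*).
Proof.
rewrite /mode /rho /= /rho0 /tensor /proj_pos (fsum_single (a := 0)).
  rewrite mulr0z mulr0 cis0 scale1r add0r sub0r oppr_eq0.
  by case: (m == 0).
move=> x x0; rewrite (_ : _ && _ = false) ?scale0r ?scaler0//; lia.
Qed.

(** Diagonal entries move both positions the same way, giving e^{i nu} or its inverse. Off-diagonal
    entries change the relative position, giving a phase in the momentum [phi]. *)
Definition phase_shift (nu phi : R) (i j : 'I_2) : C :=
  if i == j then (if i == 0 then cis nu else cis (- nu))
  else (if i == 0 then cis phi else cis (- phi)).

(** In the coordinates x + m and x - m, equal displacements translate the centre [x] and opposite
    ones translate [m]. *)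
Lemma modeS (a b c d p : R) Phi nu t m i j : 0 <= p <= 1 ->
  let U := mxC (mx2 a b c d) in
  mode U p Phi nu t.+1 m i j =
  (if i == j then (if i == 0 then cis nu else cis (- nu)) else 1) *
  coin_map U p (mode U p Phi nu t
     (if i == j then m else if i == 0 then m - 1 else m + 1)) i j.
Proof.
move=> p01 U.
pose s := if i == j then (if i == 0 then 1 else - 1 : int) else 0.
pose n := if i == j then m else if i == 0 then m - 1 else m + 1.
have st (x : int) : (x + s + m - shift i) = x + n /\ (x + s - m - shift j) = x - n.
  rewrite /s /n /shift.
  by have [->|->] := ord2_eq i; have [->|->] := ord2_eq j; rewrite /=; split; ring.
have -> : (if i == j then (if i == 0 then cis nu else cis (- nu)) else 1) = cis (nu * s%:~R).
  rewrite /s; case: ifP => _; last by rewrite mulr0z mulr0 cis0.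
  by case: ifP => _; rewrite ?mulrNz mulr1z ?mulrN mulr1.
rewrite -/n.
pose F (X : 'M[C]_2) := cis (nu * s%:~R) * coin_map U p X i j.
have FD : {morph F : X Y / X + Y}.
  move=> X Y; rewrite /F !coin_map_coef// -mulrDr -big_split /=; congr (_ * _).
  apply: eq_bigr => k _; rewrite -big_split /=; apply: eq_bigr => l _.
  by rewrite addmxE mulrDr.
rewrite [RHS](fsum_morph FD (mode_support _ _ _ _ _ _)).
rewrite /mode (@fsum_morph _ _ (fun X : 'M[C]_2 => X i j)); last 2 first.
- by move=> X Y; exact: addmxE.
- exact: mode_support.
(* Recentring the sum by the displacement [s] of the centre releases the phase e^{i nu s}. *)
rewrite (reindex_fsbigT (fun x => x + s)); last first.
  by exists (fun x => x - s) => x; rewrite ?addrK ?subrK.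
apply: eq_fsbigr => x _ /=.
rewrite scalemxE /rho stepE.
have [-> ->] := st x.
rewrite /F !coin_map_coef// intrD mulrDr addrC cisD -mulrA; congr (_ * _).
rewrite mulr_sumr; apply: eq_bigr => k _; rewrite mulr_sumr; apply: eq_bigr => l _.
by rewrite scalemxE mulrCA.
Qed.

End Mode.

(** * Bloch coordinates and Fourier representation of the modes *)

Section BlochCoordinates.
Variable R : realType.
Local Notation C := R[i].
Local Notation bloch := (R * R * R * R)%type.

(* The matrix whose coordinates, in the convention of bloch_step, are u - i w;
   as bloch_step is real, u and w evolve separately. *)
Definition of_bloch (u w : bloch) : 'M[C]_2 :=
  let: (ua, uz, ux, uy) := u in let: (wa, wz, wx, wy) := w in
  \matrix_(i, j)
    (if i == 0 then
       if j == 0 then ((ua + wz) / 2) +i* ((uz - wa) / 2)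
       else ((wx + uy) / 2) +i* ((ux - wy) / 2)
     else
       if j == 0 then ((wx - uy) / 2) +i* ((ux + wy) / 2)
       else ((ua - wz) / 2) +i* (- (uz + wa) / 2)).

(* The factors c^2 + s^2 make the identities below hold as ring identities. *)
Lemma bloch_stepE (q c s f e a z x y : R) : c ^+ 2 + s ^+ 2 = 1 ->
  bloch_step q c s f e (a, z, x, y) =
  (cos e * ((c ^+ 2 + s ^+ 2) * a) -
     sin e * ((c ^+ 2 - s ^+ 2) * z - 2 * c * s * q * x),
   sin e * ((c ^+ 2 + s ^+ 2) * a) +
     cos e * ((c ^+ 2 - s ^+ 2) * z - 2 * c * s * q * x),
   cos f * (2 * c * s * z + (c ^+ 2 - s ^+ 2) * q * x) + sin f * (q * ((c ^+ 2 + s ^+ 2) * y)),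
   cos f * (q * ((c ^+ 2 + s ^+ 2) * y)) - sin f * (2 * c * s * z + (c ^+ 2 - s ^+ 2) * q * x)).
Proof. by move=> cs1; rewrite cs1 !mul1r. Qed.

(** Conjugation by a rotation of angle theta rotates the Pauli coordinates (z, x) by 2 theta, which
    is where c^2 - s^2 and 2cs in [bloch_step] come from. *)
Lemma of_bloch_step_rot (p c s nu phi : R) (u w : bloch) i j :
  0 <= p <= 1 -> c ^+ 2 + s ^+ 2 = 1 ->
  phase_shift nu phi i j * coin_map (mxC (mx2 c (- s) s c)) p (of_bloch u w) i j =
  of_bloch (bloch_step (1 - p) c s phi nu u) (bloch_step (1 - p) c s phi nu w) i j.
Proof.
move=> p01 cs1; case: u => [[[ua uz] ux] uy]; case: w => [[[wa wz] wx] wy].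
rewrite !bloch_stepE// coin_map_coef// !big_ord_recl !big_ord0 /coin_coef !mxE /=.
rewrite /phase_shift /cis.
have [->|->] := ord2_eq i; have [->|->] := ord2_eq j; rewrite /= ?cosN ?sinN.
all: apply/eqP; rewrite eq_complex; apply/andP; split; apply/eqP => /=; field; exact: isT.
Qed.

(** The reflection is the rotation times diag(1, -1). Conjugation by the latter negates the
    off-diagonal entries, hence the damping factor -(1 - p). *)
Lemma of_bloch_step_refl (p c s nu phi : R) (u w : bloch) i j :
  0 <= p <= 1 -> c ^+ 2 + s ^+ 2 = 1 ->
  phase_shift nu phi i j * coin_map (mxC (mx2 c s s (- c))) p (of_bloch u w) i j =
  of_bloch (bloch_step (- (1 - p)) c s phi nu u) (bloch_step (- (1 - p)) c s phi nu w) i j.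
Proof.
move=> p01 cs1; case: u => [[[ua uz] ux] uy]; case: w => [[[wa wz] wx] wy].
rewrite !bloch_stepE// coin_map_coef// !big_ord_recl !big_ord0 /coin_coef !mxE /=.
rewrite /phase_shift /cis.
have [->|->] := ord2_eq i; have [->|->] := ord2_eq j; rewrite /= ?cosN ?sinN.
all: apply/eqP; rewrite eq_complex; apply/andP; split; apply/eqP => /=; field; exact: isT.
Qed.

Definition bcont (u : R -> bloch) : Prop :=
  [/\ continuous (fun k => (u k).1.1.1), continuous (fun k => (u k).1.1.2),
      continuous (fun k => (u k).1.2) & continuous (fun k => (u k).2)].

Ltac solve_continuous :=
  repeat lazymatch goal with
  | |- forall x, continuous_at x (fun k => _ + _) => apply: continuousD_fun
  | |- forall x, continuous_at x (fun k => _ * _) => apply: continuousM_fun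
  | |- forall x, continuous_at x (fun k => - _) => apply: continuousN_fun
  | |- forall x, continuous_at x (fun k => ?c) => exact: continuous_cst_fun
  end.

Lemma bcont_step (q c s e al : R) (u : R -> bloch) :
  bcont u -> bcont (fun k => bloch_step q c s (k + al) e (u k)).
Proof.
move=> [ca cz cx cy].
have E k : bloch_step q c s (k + al) e (u k) =
  let z1 := (c ^+ 2 - s ^+ 2) * (u k).1.1.2 + - (2 * c * s * q * (u k).1.2) in
  let x1 := 2 * c * s * (u k).1.1.2 + (c ^+ 2 - s ^+ 2) * q * (u k).1.2 in
  let y1 := q * (u k).2 in
  (cos e * (u k).1.1.1 + - (sin e * z1), sin e * (u k).1.1.1 + cos e * z1,
   cos (k + al) * x1 + sin (k + al) * y1, cos (k + al) * y1 + - (sin (k + al) * x1)).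
  by case: (u k) => [[[]]].
have cal : continuous (fun k : R => k + al).
  by apply: continuousD_fun; [by move=> y; exact: cvg_id|exact: continuous_cst_fun].
have ccos : continuous (fun k => cos (k + al)) by have [] := ccont_cis cal.
have csin : continuous (fun k => sin (k + al)) by have [] := ccont_cis cal.
rewrite (funext E) /bcont /=.
split; solve_continuous; assumption.
Qed.

(** The offset [al] of the momentum is free by periodicity. It is chosen at the end to match the
    cosine in the stated variance. *)
Definition bloch_iter (q c s e al : R) (u : bloch) t (k : R) : bloch :=
  iter t (bloch_step q c s (k + al) e) u.

Lemma bcont_iter (q c s e al : R) (u : bloch) t : bcont (bloch_iter q c s e al u t).
Proof.
elim: t => [|t IH]; first by split; exact: continuous_cst_fun.
exact: bcont_step.
Qed.

Lemma ccont_of_bloch (u w : R -> bloch) i j :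
  bcont u -> bcont w -> ccont (fun k => of_bloch (u k) (w k) i j).
Proof.
move=> [ua uz ux uy] [wa wz wx wy].
have E k : of_bloch (u k) (w k) i j =
    (if i == 0 then
       if j == 0 then
         (((u k).1.1.1 + (w k).1.1.2) * 2^-1) +i* (((u k).1.1.2 + - (w k).1.1.1) * 2^-1)
       else (((w k).1.2 + (u k).2) * 2^-1) +i* (((u k).1.2 + - (w k).2) * 2^-1)
     else
       if j == 0 then (((w k).1.2 + - (u k).2) * 2^-1) +i* (((u k).1.2 + (w k).2) * 2^-1)
       else (((u k).1.1.1 + - (w k).1.1.2) * 2^-1) +i* (- ((u k).1.1.2 + (w k).1.1.1) * 2^-1)).
  by rewrite /of_bloch; case: (u k) => [[[? ?] ?] ?]; case: (w k) => [[[? ?] ?] ?]; rewrite mxE.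
rewrite (funext E) /ccont.
by have [->|->] := ord2_eq i; have [->|->] := ord2_eq j; split => /=; solve_continuous; assumption.
Qed.

(** Fourier inversion by induction on time. The initial state sits at m = 0, so its transform is
    constant in k and orthogonality of characters gives the base case; [modeS] gives the step. *)
Lemma mode_fourier (a b c d p q co si nu al : R) (Phi : 'cV[C]_2) (u w : bloch) :
  0 <= p <= 1 ->
  let U := mxC (mx2 a b c d) in
  (forall phi u w i j, phase_shift nu phi i j * coin_map U p (of_bloch u w) i j =
    of_bloch (bloch_step q co si phi nu u) (bloch_step q co si phi nu w) i j) ->
  of_bloch u w = Phi *m Phi ^t* ->
  forall t m i j, mode U p Phi nu t m i j =
    cmean (fun k => cis (- (m%:~R * (k + al))) *
       of_bloch (bloch_iter q co si nu al u t k) (bloch_iter q co si nu al w t k) i j).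
Proof.
move=> p01 U stepE0 uw.
have cc t m i j : ccont (fun k => cis (- (m%:~R * (k + al))) *
   of_bloch (bloch_iter q co si nu al u t k) (bloch_iter q co si nu al w t k) i j).
  apply: ccontM; last by apply: ccont_of_bloch; exact: bcont_iter.
  apply: ccont_cis; apply: continuousN_fun; apply: continuousM_fun.
    exact: continuous_cst_fun.
  by apply: continuousD_fun; [by move=> y; exact: cvg_id|exact: continuous_cst_fun].
elim=> [|t IH] m i j.
  rewrite mode0 scalemxE -uw mulrC /bloch_iter /=.
  under eq_fun do rewrite mulrC.
  rewrite cmeanZ ?cmean_cis//.
  apply: ccont_cis; apply: continuousN_fun; apply: continuousM_fun.
    exact: continuous_cst_fun.
  by apply: continuousD_fun; [by move=> y; exact: cvg_id|exact: continuous_cst_fun].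
rewrite modeS// coin_map_coef//.
set n := if i == j then m else _; set pre := if i == j then _ else 1.
have cc2 k l : ccont (fun x => coin_coef a b c d p i j k l * (cis (- (n%:~R * (x + al))) *
   of_bloch (bloch_iter q co si nu al u t x) (bloch_iter q co si nu al w t x) k l)).
  by apply: ccontM => //; exact: ccont_cst.
transitivity (pre * \sum_k \sum_l cmean (fun x => coin_coef a b c d p i j k l *
   (cis (- (n%:~R * (x + al))) * of_bloch (bloch_iter q co si nu al u t x) (bloch_iter q co si nu al w t x) k l))).
  congr (_ * _); apply: eq_bigr => k _; apply: eq_bigr => l _.
  by rewrite cmeanZ// IH.
under eq_bigr do rewrite -cmean_sum//.
rewrite -cmean_sum; last by move=> k; exact: ccont_sum.
rewrite -cmeanZ; last by apply: ccont_sum => k; exact: ccont_sum.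
congr cmean; apply/funext => x.
rewrite [in RHS]/bloch_iter 2!iterS -stepE0
  -/(bloch_iter q co si nu al u t x) -/(bloch_iter q co si nu al w t x).
rewrite coin_map_coef// mulrA.
(* The move from [m] to m - 1 or m + 1 on off-diagonal entries is a factor e^{i(x + al)} or its
   inverse, exactly the momentum phase of [phase_shift]. *)
have -> : cis (- (m%:~R * (x + al))) * phase_shift nu (x + al) i j =
    pre * cis (- (n%:~R * (x + al))).
  rewrite /phase_shift /pre /n.
  case: (i == j); first by rewrite mulrC.
  rewrite mul1r -(fun_if (@cis R)) -cisD; congr cis.
  by case: (i == 0); rewrite ?intrD ?intrB ?mulr1z; ring.
rewrite -mulrA; congr (_ * _); rewrite mulr_sumr; apply: eq_bigr => k _.
rewrite mulr_sumr; apply: eq_bigr => l _.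
by rewrite mulrCA.
Qed.

End BlochCoordinates.

(** * The limit *)

Section Limit.
Variable R : realType.
Local Notation C := R[i].

(** Dominated convergence with a constant bound on a bounded interval. The limit is measurable as a
    pointwise limit of continuous functions. *)
Lemma fourier_mean_cvg (f : nat -> R -> R) (g : R -> R) (M : R) :
  (forall t, continuous (f t)) -> (forall t k, `|f t k| <= M) ->
  (forall k, f t k @[t --> \oo] --> g k) ->
  fourier_mean (f t) @[t --> \oo] --> fourier_mean g.
Proof.
move=> cf fM fg; rewrite /fourier_mean.
have mf t := measurable_int _ (integrable_period (cf t)).
have fgE k : `[0, 2 * pi]%classic k -> (EFin \o f t) k @[t --> \oo] --> (EFin \o g) k.
  by move=> _; apply: cvg_EFin; [exact: nearW|exact: fg].
have iM := integrable_period (@continuous_cst_fun R M).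
have fM' t k : `[0, 2 * pi]%classic k -> (`|(EFin \o f t) k| <= (EFin \o (fun=> M)) k)%E.
  by move=> _; rewrite lee_fin.
have mg := @measurable_realfun.emeasurable_fun_cvg _ (measurableTypeR R) _ _ _ _ mf fgE.
have [] := @dominated_convergence _ _ R (@lebesgue_measure R)
  `[0, 2 * pi] (measurable_itv _) (fun t => EFin \o f t) (EFin \o g)
  (EFin \o (fun=> M)) mf mg.
- by apply: aeW => k; exact: fgE.
- exact: iM.
- by apply: aeW => k t; exact: fM'.
move=> ig _.
rewrite -[X in _ --> X -> _]fineK; last exact: integrable_fin_num.
move=> /fine_cvg h.
by apply: cvgMl_tmp.
Qed.

Lemma cvg_complex (f g : nat -> R) (a b : R) :
  f t @[t --> \oo] --> a -> g t @[t --> \oo] --> b ->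
  (fun t => (f t +i* g t : C^o)) @ \oo --> (a +i* b : C^o).
Proof.
move=> fa gb; apply/cvgrPdist_le => e e0.
have [er e1] : 0 < complex.Re e /\ e = (complex.Re e)%:C.
  by case: (e) e0 => x y; rewrite ltcE /= => /andP[/eqP -> ?].
have e2 : 0 < complex.Re e / 2 by rewrite divr_gt0.
near=> t.
rewrite e1.
have -> : (a +i* b : C^o) - (f t +i* g t) = (a - f t)%:C + 'i%C * (b - g t)%:C.
  by apply/eqP; rewrite eq_complex /=; apply/andP; split; apply/eqP; ring.
rewrite (le_trans (ler_normD _ _))// normrM.
have -> : `|'i%C : C| = 1 by rewrite normc_def /= expr0n expr1n add0r sqrtr1.
have nr (x : R) : `|x%:C| = `|x|%:C by rewrite normc_def /= expr0n addr0 sqrtr_sqr.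
rewrite mul1r !nr -rmorphD lecR /=.
rewrite [leRHS](splitr (complex.Re e)) lerD//.
  by near: t; move/cvgrPdist_le : fa; apply.
by near: t; move/cvgrPdist_le : gb; apply.
Unshelve. all: by end_near. Qed.

(** The trace of [of_bloch u w] is the trace coordinate of [u] minus i times that of [w]. *)
Lemma Phat_bloch (a b c d p q co si nu al : R) (Phi : 'cV[C]_2) (u w : R * R * R * R) :
  0 <= p <= 1 ->
  let U := mxC (mx2 a b c d) in
  (forall phi u w i j, phase_shift nu phi i j * coin_map U p (of_bloch u w) i j =
    of_bloch (bloch_step q co si phi nu u) (bloch_step q co si phi nu w) i j) ->
  of_bloch u w = Phi *m Phi ^t* ->
  forall t, Phat U p Phi nu t =
    fourier_mean (fun k => (bloch_iter q co si nu al u t k).1.1.1) +i*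
    fourier_mean (fun k => - (bloch_iter q co si nu al w t k).1.1.1).
Proof.
move=> p01 U stepE0 uw t.
have cc i : ccont (fun k => of_bloch (bloch_iter q co si nu al u t k)
                                     (bloch_iter q co si nu al w t k) i i).
  by apply: ccont_of_bloch; exact: bcont_iter.
have diagE i : mode U p Phi nu t 0 i i =
    cmean (fun k => of_bloch (bloch_iter q co si nu al u t k)
                             (bloch_iter q co si nu al w t k) i i).
  rewrite (mode_fourier al p01 stepE0 uw); congr cmean; apply/funext => k.
  by rewrite mulr0z mul0r oppr0 cis0 mul1r.
rewrite Phat_mode /mxtrace (eq_bigr _ (fun i _ => diagE i)) -cmean_sum//.
rewrite /cmean; congr (_ +i* _); congr fourier_mean; apply/funext => k;
  rewrite !big_ord_recl big_ord0 /of_bloch;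
  case: (bloch_iter q co si nu al u t k) => [[[? ?] ?] ?];
  case: (bloch_iter q co si nu al w t k) => [[[? ?] ?] ?]; rewrite !mxE /=; field; exact: isT.
Qed.

(** The usual Bloch vector (x, y, z) of a pure state. The identity part goes to the first quadruple
    and the traceless part to the second, which starts with zero trace coordinate. *)
Lemma pure_state_bloch (Phi : 'cV[C]_2) : Phi ^t* *m Phi = 1%:M ->
  exists x y z : R, of_bloch (1, 0, 0, 0) (0, z, x, y) = Phi *m Phi ^t*.
Proof.
move=> /matrixP /(_ 0 0); rewrite !mxE !big_ord_recl big_ord0 !mxE /=.
have -> : lift ord0 ord0 = 1 :> 'I_2 by apply/val_inj.
case E0 : (Phi 0 0) => [a1 a2]; case E1 : (Phi 1 0) => [b1 b2].
rewrite addr0 => /eqP; rewrite eq_complex => /andP[/eqP /= h _].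
exists (2 * (a1 * b1 + a2 * b2)), (- 2 * (a2 * b1 - a1 * b2)),
  (a1 ^+ 2 + a2 ^+ 2 - (b1 ^+ 2 + b2 ^+ 2)).
apply/matrixP => i j; rewrite !mxE big_ord1 !mxE.
by have [->|->] := ord2_eq i; have [->|->] := ord2_eq j; rewrite ?E0 ?E1 /=;
  apply/eqP; rewrite eq_complex /=; apply/andP; split; apply/eqP; lra.
Qed.

Lemma bloch_iter_bounded (q c s e al : R) u : c ^+ 2 + s ^+ 2 = 1 -> q ^+ 2 <= 1 ->
  forall t k, `|(bloch_iter q c s e al u t k).1.1.1| <= 1 + bloch_norm2 u.
Proof.
move=> cs1 q1 t k.
have un0 : 0 <= bloch_norm2 u.
  by case: (u) => [[[a z] x] y] /=; rewrite !addr_ge0 ?sqr_ge0.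
have N0 : 0 <= 1 + bloch_norm2 u by rewrite addr_ge0.
have uN : bloch_norm2 (bloch_iter q c s e al u t k) <= (1 + bloch_norm2 u) ^+ 2.
  apply: (@le_trans _ _ (bloch_norm2 u)); last by nra.
  apply: (@iter_le_nonincreasing _ _ (bloch_step q c s (k + al) e) (@bloch_norm2 R)) => w.
  exact: bloch_step_contract.
by have [] := bloch_coord_le N0 uN.
Qed.

(** By [bloch_iter_cvg] only the initial trace coordinate survives: it is 1 for the real part and 0
    for the imaginary part, so the limit is real and independent of [Phi]. *)
Lemma Phat_cvg (a b c d p q co si nu al : R) (Phi : 'cV[C]_2) :
  0 <= p <= 1 -> co ^+ 2 + si ^+ 2 = 1 -> si != 0 -> q ^+ 2 < 1 -> 0 <= nu ->
  let U := mxC (mx2 a b c d) in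
  (forall e phi u w i j, phase_shift e phi i j * coin_map U p (of_bloch u w) i j =
    of_bloch (bloch_step q co si phi e u) (bloch_step q co si phi e w) i j) ->
  Phi ^t* *m Phi = 1%:M ->
  (fun t : nat => Phat U p Phi (nu / Num.sqrt t%:R) t : C^o) @ \oo -->
  ((fourier_mean (fun k => expR (- (walk_var q co si (k + al) * nu ^+ 2 / 2))))%:C : C^o).
Proof.
move=> p01 cs1 s0 q1 nu0 U stepE0 /pure_state_bloch[x [y [z uw]]].
have q1' : q ^+ 2 <= 1 by exact: ltW.
under eq_fun do rewrite (Phat_bloch al p01 (stepE0 _) uw).
(* The zero imaginary part is written as the mean of the pointwise limits, the form that
   [fourier_mean_cvg] produces. *)
have e0 : (0 : R) = fourier_mean (fun k =>
    - (expR (- (walk_var q co si (k + al) * nu ^+ 2 / 2)) * 0)).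
  by under eq_fun do rewrite mulr0 oppr0; rewrite fourier_mean_cst.
apply: cvg_complex.
- apply: (@fourier_mean_cvg _ _ (1 + bloch_norm2 (1, 0, 0, 0))) => [t|t k|k].
  + by have [] := bcont_iter q co si (nu / Num.sqrt t%:R) al (1, 0, 0, 0) t.
  + exact: bloch_iter_bounded.
  + rewrite -[X in _ --> X]mulr1.
    exact: (@bloch_iter_cvg R q co si (k + al) nu (1, 0, 0, 0)).
- rewrite [X in _ --> X]e0.
  apply: (@fourier_mean_cvg _ _ (1 + bloch_norm2 (0, z, x, y))) => [t|t k|k].
  + by apply: continuousN_fun; have [] := bcont_iter q co si (nu / Num.sqrt t%:R) al (0, z, x, y) t.
  + by rewrite normrN; exact: bloch_iter_bounded.
  + apply: cvgN.
    exact: (@bloch_iter_cvg R q co si (k + al) nu (0, z, x, y)).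
Qed.

Lemma sin_neq0 (x : R) : 0 <= x < 2 * pi -> x <> 0 -> x <> pi -> sin x != 0.
Proof.
move=> /andP[x0 x2pi] /eqP xn0 /eqP xnpi.
have xp : 0 < x by rewrite lt_neqAle eq_sym xn0.
case: (ltgtP x pi) => [xpi|pix|/eqP]; last by rewrite (negbTE xnpi).
  by rewrite gt_eqF// sin_gt0_pi ?xp.
rewrite -(subrK pi x) sinDpi oppr_eq0 gt_eqF// sin_gt0_pi//.
by apply/andP; split; lra.
Qed.

End Limit.

Theorem mainTheorem4 (R : realType) (p q theta : R) (U : 'M[R]_2)
    (Phi0 : 'cV[R[i]]_2)
    (hp : 0 < p < 1) (hq : q = 1 - p)
    (htheta : 0 <= theta < 2 * pi)
    (htheta' : forall n : nat, (n <= 3)%N -> theta <> n%:R * pi / 2)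
    (hU : U = coin_rot theta \/ U = coin_refl theta)
    (hPhi0 : Phi0 ^t* *m Phi0 = 1%:M)
    (nu : R) (hnu : 0 <= nu <= 2 * pi) :
  (fun t : nat => Phat (mxC U) p Phi0 (nu / Num.sqrt t%:R) t : (R[i])^o) @ \oo -->
  (((2 * pi)^-1 *
    \int[lebesgue_measure]_(k in `[0, 2 * pi])
      expR (- (1 / 2) * ((1 + 2 * q * cos k + q ^+ 2) / (1 - q ^+ 2))
            * cot theta ^+ 2 * nu ^+ 2))%:C : (R[i])^o).
Proof.
have s0 : sin theta != 0.
  apply: sin_neq0 => //.
    by have := htheta' 0%N isT; rewrite mul0r mul0r.
  by have := htheta' 2%N isT; rewrite mulrAC divff ?mul1r// pnatr_eq0.
have p01 : 0 <= p <= 1 by move: hp => /andP[? ?]; apply/andP; split; lra.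
have q1 : (1 - p) ^+ 2 < 1 by move: hp => /andP[? ?]; nra.
have nu0 : 0 <= nu by case/andP: hnu.
have cs1 := cos2Dsin2 theta.
have limit al r (v : R -> R) :
    (forall k, v (k + al) =
       (1 + 2 * q * cos k + q ^+ 2) / (1 - q ^+ 2) * (cos theta / sin theta) ^+ 2) ->
    fourier_mean (fun k => expR (- (v (k + al) * nu ^+ 2 / 2))) = r ->
    (2 * pi)^-1 * \int[lebesgue_measure]_(k in `[0, 2 * pi])
      expR (- (1 / 2) * ((1 + 2 * q * cos k + q ^+ 2) / (1 - q ^+ 2))
            * cot theta ^+ 2 * nu ^+ 2) = r.
  move=> vE <-; congr (_ * _); apply: eq_Rintegral => k _; congr expR.
  by rewrite vE /cot; set X := _ / (1 - _); set Y := cos theta / _; field; exact: isT.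
case: hU => ->.
(* The offset pi changes the sign of the cosine in [walk_var]. *)
- rewrite (limit pi _ (walk_var (1 - p) (cos theta) (sin theta)) _ erefl).
    apply: Phat_cvg => // e phi u w i j; exact: of_bloch_step_rot.
  by move=> k; rewrite /walk_var cosDpi hq; congr (_ / _ * _); ring.
(* The damping factor -q already gives the right sign, so the offset is 0. *)
- rewrite (limit 0 _ (walk_var (- (1 - p)) (cos theta) (sin theta)) _ erefl).
    apply: Phat_cvg => //; first by rewrite sqrrN.
    move=> e phi u w i j; exact: of_bloch_step_refl.
  by move=> k; rewrite /walk_var addr0 hq sqrrN; congr (_ / _ * _); ring.
Qed.
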